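(* Let $\mathbb{H}=(H_1,H_2)$ be a Hopf brace in a strict braided monoidal category $\mathsf{C}$, and consider the invertible 1-cocycle $id_H:H_2\to H_1$ with action $\Gamma_{H_1}$. There exists a functor $$\mathsf{G}_{\mathbb{H}}:{}_{\mathbb{H}}\mathsf{Mod}\to{}_{(id_H,\Gamma_{H_1})}\mathsf{Mod}$$ defined on objects by $$\mathsf{G}_{\mathbb{H}}((M,\psi_M^1,\psi_M^2))=(M,M,\widehat{\phi}_M=\Gamma_M,\widehat{\varphi}_M=\psi_M^1,\overline{\phi}_M=\psi_M^2,id_M)$$ and on morphisms by $\mathsf{G}_{\mathbb{H}}(f)=(f,f)$.
   Context: $\mathsf{C}$ is a strict braided monoidal category with tensor product $\otimes$, unit object $K$ and braiding $c$. For an object $P$ and a morphism $f$, one writes $P\otimes f$ for $id_P\otimes f$ and $f\otimes P$ for $f\otimes id_P$. A Hopf algebra $H$ in $\mathsf{C}$ has unit $\eta_H$, product $\mu_H$, counit $\varepsilon_H$, coproduct $\delta_H$ and antipode $\lambda_H$ (the convolution inverse of $id_H$), where the tensor product of algebras (coalgebras) is an algebra (coalgebra) via the braiding $c$. Left modules over an algebra and their morphisms are the usual ones. Hopf brace: let $(H,\varepsilon_H,\delta_H)$ be a coalgebra with two algebra structures $(H,\eta_H^1,\mu_H^1)$, $(H,\eta_H^2,\mu_H^2)$ and endomorphisms $\lambda_H^1,\lambda_H^2$ of $H$. These data form a Hopf brace $\mathbb{H}=(H_1,H_2)$ if $H_i=(H,\eta_H^i,\mu_H^i,\varepsilon_H,\delta_H,\lambda_H^i)$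 is a Hopf algebra in $\mathsf{C}$ for $i=1,2$ and $$\mu_H^2\circ(H\otimes\mu_H^1)=\mu_H^1\circ(\mu_H^2\otimes\Gamma_{H_1})\circ(H\otimes c_{H,H}\otimes H)\circ(\delta_H\otimes H\otimes H),$$ where $\Gamma_{H_1}=\mu_H^1\circ(\lambda_H^1\otimes\mu_H^2)\circ(\delta_H\otimes H)$. Left $\mathbb{H}$-module: a triple $(M,\psi_M^1,\psi_M^2)$ where $(M,\psi_M^1)$ is a left $H_1$-module, $(M,\psi_M^2)$ is a left $H_2$-module and $$\psi_M^2\circ(H\otimes\psi_M^1)=\psi_M^1\circ(\mu_H^2\otimes\Gamma_M)\circ(H\otimes c_{H,H}\otimes M)\circ(\delta_H\otimes H\otimes M),$$ where $\Gamma_M=\psi_M^1\circ(\lambda_H^1\otimes\psi_M^2)\circ(\delta_H\otimes M)$. Morphisms of left $\mathbb{H}$-modules are morphisms in $\mathsf{C}$ that are morphisms of left $H_1$-modules and of left $H_2$-modules; the resulting category is ${}_{\mathbb{H}}\mathsf{Mod}$. Module algebra: for a Hopf algebra $D$, an algebra $B$ is a left $D$-module algebra with action $\phi_B:D\otimes B\to B$ if $(B,\phi_B)$ is a left $D$-module, $\phi_B\circ(D\otimes\eta_B)=\varepsilon_D\otimes\eta_B$ and $\phi_B\circ(D\otimes\mu_B)=\mu_B\circ(\phi_B\otimes\phi_B)\circ(D\otimes c_{D,B}\otimes B)\circ(\delta_D\otimes B\otimes B)$. Invertible 1-cocycle: let $A,H$ be Hopf algebras in $\mathsf{C}$ such that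 $H$ is a left $A$-module algebra with action $\phi_H$. A coalgebra morphism $\pi:A\to H$ is an invertible 1-cocycle (with action $\phi_H$) if it is an isomorphism and $\pi\circ\mu_A=\mu_H\circ(\pi\otimes\phi_H)\circ(\delta_A\otimes\pi)$. For a Hopf brace $\mathbb{H}$, it is known that $(H,\eta_H^1,\mu_H^1)$ is a left $H_2$-module algebra with action $\Gamma_{H_1}$ and that $id_H:H_2\to H_1$ is an invertible 1-cocycle with this action. A left module over an invertible 1-cocycle $\pi:A\to H$ with action $\phi_H$ is a 6-tuple $(M,N,\phi_M,\varphi_M,\phi_N,\gamma)$ where: (i) $(M,\phi_M)$ is a left $A$-module, $(M,\varphi_M)$ is a left $H$-module and $\phi_M\circ(A\otimes\varphi_M)=\varphi_M\circ(\phi_H\otimes\phi_M)\circ(A\otimes c_{A,H}\otimes M)\circ(\delta_A\otimes H\otimes M)$; (ii) $(N,\phi_N)$ is a left $A$-module; (iii) $\gamma:N\to M$ is an isomorphism in $\mathsf{C}$ with $\gamma\circ\phi_N=\varphi_M\circ(\pi\otimes\phi_M)\circ(\delta_A\otimes\gamma)$. A morphism $(M,N,\phi_M,\varphi_M,\phi_N,\gamma)\to(M',N',\phi_{M'},\varphi_{M'},\phi_{N'},\gamma')$ is a pair $(h,l)$ with $h:M\to M'$ a morphism of left $A$-modules and of left $H$-modules, $l:N\to N'$ a morphism of left $A$-modules and $h\circ\gamma=\gamma'\circ l$. These form the category ${}_{(\pi,\phi_H)}\mathsf{Mod}$. *)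

(* Defs.v *)
From Stdlib Require Import ProofIrrelevance.

Set Implicit Arguments.
Unset Strict Implicit.
Unset Printing Implicit Defensive.

Declare Scope cat_scope.
Delimit Scope cat_scope with cat.
Open Scope cat_scope.

Record Category := {
  Ob :> Type;
  Hom : Ob -> Ob -> Type;
  idm : forall A, Hom A A;
  comp : forall A B D, Hom B D -> Hom A B -> Hom A D;
  comp_idl : forall A B (f : Hom A B), comp (idm B) f = f;
  comp_idr : forall A B (f : Hom A B), comp f (idm A) = f;
  comp_assoc : forall A B D E (h : Hom D E) (g : Hom B D) (f : Hom A B),
    comp h (comp g f) = comp (comp h g) f
}.

Arguments Hom {c} A B.
Arguments idm {c} A.
Arguments comp {c A B D} g f.

Notation "g ∘ f" := (comp g f) (at level 40, left associativity) : cat_scope.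

Definition is_iso (C : Category) (A B : C) (f : Hom A B) : Prop :=
  exists g : Hom B A, g ∘ f = idm A /\ f ∘ g = idm B.

Record IsFunctor (C D : Category) (F0 : C -> D)
    (F1 : forall X Y : C, Hom X Y -> Hom (F0 X) (F0 Y)) : Prop := {
  functor_id : forall X : C, F1 X X (idm X) = idm (F0 X);
  functor_comp : forall (X Y Z : C) (g : Hom Y Z) (f : Hom X Y),
    F1 X Z (g ∘ f) = F1 Y Z g ∘ F1 X Y f
}.

(* The identity of A, seen as a morphism A -> B along an equality of objects.
   In a strict monoidal category (A ⊗ B) ⊗ D and A ⊗ (B ⊗ D) are equal but not
   convertible, so composites that silently identify them are written with
   these identities. *)
Definition eqhom (C : Category) (A B : C) (e : A = B) : Hom A B :=
  match e in _ = X return Hom A X with eq_refl => idm A end.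

(* Strictness of the tensor product is equality on objects and, modulo eqhom,
   on morphisms.  The pentagon and triangle need no axiom: all the morphisms
   involved are eqhom's, hence equal by proof irrelevance. *)
Record StrictMonoidalCategory := {
  smc_cat :> Category;
  tens : smc_cat -> smc_cat -> smc_cat;
  unitob : smc_cat;
  tensm : forall A A' B B' : smc_cat,
    Hom A A' -> Hom B B' -> Hom (tens A B) (tens A' B');
  tensm_id : forall A B : smc_cat, tensm (idm A) (idm B) = idm (tens A B);
  tensm_comp : forall (A A' A'' B B' B'' : smc_cat)
      (f' : Hom A' A'') (f : Hom A A') (g' : Hom B' B'') (g : Hom B B'),
    tensm (f' ∘ f) (g' ∘ g) = tensm f' g' ∘ tensm f g;
  tens_assoc : forall A B D : smc_cat, tens (tens A B) D = tens A (tens B D);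
  tens_unitl : forall A : smc_cat, tens unitob A = A;
  tens_unitr : forall A : smc_cat, tens A unitob = A;
  tensm_assoc : forall (A A' B B' D D' : smc_cat)
      (f : Hom A A') (g : Hom B B') (h : Hom D D'),
    eqhom (tens_assoc A' B' D') ∘ tensm (tensm f g) h
    = tensm f (tensm g h) ∘ eqhom (tens_assoc A B D);
  tensm_unitl : forall (A A' : smc_cat) (f : Hom A A'),
    eqhom (tens_unitl A') ∘ tensm (idm unitob) f = f ∘ eqhom (tens_unitl A);
  tensm_unitr : forall (A A' : smc_cat) (f : Hom A A'),
    eqhom (tens_unitr A') ∘ tensm f (idm unitob) = f ∘ eqhom (tens_unitr A)
}.

Arguments tens {s} A B.
Arguments unitob {s}.
Arguments tensm {s A A' B B'} f g.

Notation "A ⊗ B" := (tens A B) (at level 35, right associativity) : cat_scope.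
Notation "f ⊠ g" := (tensm f g) (at level 35, right associativity) : cat_scope.
Notation K := unitob.

Section StrictIdentities.
Variable C : StrictMonoidalCategory.

Definition asc (A B D : C) : Hom ((A ⊗ B) ⊗ D) (A ⊗ (B ⊗ D)) :=
  eqhom (tens_assoc A B D).
Definition asci (A B D : C) : Hom (A ⊗ (B ⊗ D)) ((A ⊗ B) ⊗ D) :=
  eqhom (eq_sym (tens_assoc A B D)).
Definition lu (A : C) : Hom (K ⊗ A) A := eqhom (tens_unitl A).
Definition lui (A : C) : Hom A (K ⊗ A) := eqhom (eq_sym (tens_unitl A)).
Definition ru (A : C) : Hom (A ⊗ K) A := eqhom (tens_unitr A).
Definition rui (A : C) : Hom A (A ⊗ K) := eqhom (eq_sym (tens_unitr A)).
End StrictIdentities.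

Record StrictBraidedCategory := {
  sbc_smc :> StrictMonoidalCategory;
  braid : forall A B : sbc_smc, Hom (A ⊗ B) (B ⊗ A);
  braid_iso : forall A B, is_iso (braid A B);
  braid_nat : forall (A A' B B' : sbc_smc) (f : Hom A A') (g : Hom B B'),
    braid A' B' ∘ (f ⊠ g) = (g ⊠ f) ∘ braid A B;
  braid_hexr : forall A B D : sbc_smc,
    braid A (B ⊗ D)
    = asci B D A ∘ (idm B ⊠ braid A D) ∘ asc B A D ∘ (braid A B ⊠ idm D)
      ∘ asci A B D;
  braid_hexl : forall A B D : sbc_smc,
    braid (A ⊗ B) D
    = asc D A B ∘ (braid A D ⊠ idm B) ∘ asci A D B ∘ (idm A ⊠ braid B D)
      ∘ asc A B D
}.

Arguments braid {s} A B.

Section Algebra.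
Variable C : StrictBraidedCategory.

(* A ⊗ c_{B,D} ⊗ E *)
Definition mid (A B D E : C) : Hom ((A ⊗ B) ⊗ (D ⊗ E)) ((A ⊗ D) ⊗ (B ⊗ E)) :=
  asci A D (B ⊗ E) ∘ (idm A ⊠ asc D B E) ∘ (idm A ⊠ (braid B D ⊠ idm E))
  ∘ (idm A ⊠ asci B D E) ∘ asc A B (D ⊗ E).

Record IsAlgebra (A : C) (eta : Hom K A) (mu : Hom (A ⊗ A) A) : Prop := {
  alg_unitl : mu ∘ (eta ⊠ idm A) = lu A;
  alg_unitr : mu ∘ (idm A ⊠ eta) = ru A;
  alg_assoc : mu ∘ (idm A ⊠ mu) ∘ asc A A A = mu ∘ (mu ⊠ idm A)
}.

Record IsCoalgebra (A : C) (eps : Hom A K) (delta : Hom A (A ⊗ A)) : Prop := {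
  coalg_counitl : (eps ⊠ idm A) ∘ delta = lui A;
  coalg_counitr : (idm A ⊠ eps) ∘ delta = rui A;
  coalg_coassoc :
    asc A A A ∘ (delta ⊠ idm A) ∘ delta = (idm A ⊠ delta) ∘ delta
}.

Record IsAlgebraMorphism (A B : C) (etaA : Hom K A) (muA : Hom (A ⊗ A) A)
    (etaB : Hom K B) (muB : Hom (B ⊗ B) B) (f : Hom A B) : Prop := {
  algm_unit : f ∘ etaA = etaB;
  algm_mul : f ∘ muA = muB ∘ (f ⊠ f)
}.

Record IsCoalgebraMorphism (A B : C) (epsA : Hom A K) (deltaA : Hom A (A ⊗ A))
    (epsB : Hom B K) (deltaB : Hom B (B ⊗ B)) (f : Hom A B) : Prop := {
  coalgm_counit : epsB ∘ f = epsA;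
  coalgm_comul : deltaB ∘ f = (f ⊠ f) ∘ deltaA
}.

Definition tens_eta (A B : C) (etaA : Hom K A) (etaB : Hom K B)
  : Hom K (A ⊗ B) := (etaA ⊠ etaB) ∘ lui K.
Definition tens_mu (A B : C) (muA : Hom (A ⊗ A) A) (muB : Hom (B ⊗ B) B)
  : Hom ((A ⊗ B) ⊗ (A ⊗ B)) (A ⊗ B) := (muA ⊠ muB) ∘ mid A B A B.

Definition convolution (A B : C) (delta : Hom A (A ⊗ A)) (mu : Hom (B ⊗ B) B)
  (f g : Hom A B) : Hom A B := mu ∘ (f ⊠ g) ∘ delta.

Record IsHopfAlgebra (H : C) (eta : Hom K H) (mu : Hom (H ⊗ H) H)
    (eps : Hom H K) (delta : Hom H (H ⊗ H)) (lam : Hom H H) : Prop := {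
  hopf_algebra : IsAlgebra eta mu;
  hopf_coalgebra : IsCoalgebra eps delta;
  hopf_eps : IsAlgebraMorphism eta mu (idm K) (lu K) eps;
  hopf_delta :
    IsAlgebraMorphism eta mu (tens_eta eta eta) (tens_mu mu mu) delta;
  hopf_antipodel : convolution delta mu lam (idm H) = eta ∘ eps;
  hopf_antipoder : convolution delta mu (idm H) lam = eta ∘ eps
}.

Record HopfAlgebra := {
  ha_ob :> C;
  ha_eta : Hom K ha_ob;
  ha_mu : Hom (ha_ob ⊗ ha_ob) ha_ob;
  ha_eps : Hom ha_ob K;
  ha_delta : Hom ha_ob (ha_ob ⊗ ha_ob);
  ha_lam : Hom ha_ob ha_ob;
  ha_ax : IsHopfAlgebra ha_eta ha_mu ha_eps ha_delta ha_lam
}.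

Record IsModule (A : HopfAlgebra) (M : C) (phi : Hom (A ⊗ M) M) : Prop := {
  mod_unit : phi ∘ (ha_eta A ⊠ idm M) = lu M;
  mod_assoc : phi ∘ (idm A ⊠ phi) ∘ asc A A M = phi ∘ (ha_mu A ⊠ idm M)
}.

Definition IsModuleMorphism (A : HopfAlgebra) (M N : C)
    (phiM : Hom (A ⊗ M) M) (phiN : Hom (A ⊗ N) N) (f : Hom M N) : Prop :=
  f ∘ phiM = phiN ∘ (idm A ⊠ f).

Record IsModuleAlgebra (D : HopfAlgebra) (B : C) (etaB : Hom K B)
    (muB : Hom (B ⊗ B) B) (phi : Hom (D ⊗ B) B) : Prop := {
  modalg_algebra : IsAlgebra etaB muB;
  modalg_module : IsModule phi;
  modalg_unit : phi ∘ (idm D ⊠ etaB) = lu B ∘ (ha_eps D ⊠ etaB);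
  modalg_mul : phi ∘ (idm D ⊠ muB)
    = muB ∘ (phi ⊠ phi) ∘ mid D D B B ∘ (ha_delta D ⊠ idm (B ⊗ B))
}.

(* Γ_M; for M = H acting on itself by its two products this is Γ_{H_1}. *)
Definition Gamma (H M : C) (delta : Hom H (H ⊗ H)) (lam1 : Hom H H)
    (psi1 psi2 : Hom (H ⊗ M) M) : Hom (H ⊗ M) M :=
  psi1 ∘ (lam1 ⊠ psi2) ∘ asc H H M ∘ (delta ⊠ idm M).

Record HopfBrace := {
  hb_ob :> C;
  hb_eps : Hom hb_ob K;
  hb_delta : Hom hb_ob (hb_ob ⊗ hb_ob);
  hb_eta1 : Hom K hb_ob;
  hb_mu1 : Hom (hb_ob ⊗ hb_ob) hb_ob;
  hb_lam1 : Hom hb_ob hb_ob;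
  hb_eta2 : Hom K hb_ob;
  hb_mu2 : Hom (hb_ob ⊗ hb_ob) hb_ob;
  hb_lam2 : Hom hb_ob hb_ob;
  hb_hopf1 : IsHopfAlgebra hb_eta1 hb_mu1 hb_eps hb_delta hb_lam1;
  hb_hopf2 : IsHopfAlgebra hb_eta2 hb_mu2 hb_eps hb_delta hb_lam2;
  hb_compat : hb_mu2 ∘ (idm hb_ob ⊠ hb_mu1)
    = hb_mu1 ∘ (hb_mu2 ⊠ Gamma hb_delta hb_lam1 hb_mu1 hb_mu2)
      ∘ mid hb_ob hb_ob hb_ob hb_ob ∘ (hb_delta ⊠ idm (hb_ob ⊗ hb_ob))
}.

Definition hb_H1 (HB : HopfBrace) : HopfAlgebra :=
  {| ha_ax := hb_hopf1 HB |}.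
Definition hb_H2 (HB : HopfBrace) : HopfAlgebra :=
  {| ha_ax := hb_hopf2 HB |}.

Definition Gamma_brace (HB : HopfBrace) : Hom (HB ⊗ HB) HB :=
  Gamma (hb_delta HB) (hb_lam1 HB) (hb_mu1 HB) (hb_mu2 HB).

Definition Gamma_mod (HB : HopfBrace) (M : C) (psi1 psi2 : Hom (HB ⊗ M) M)
  : Hom (HB ⊗ M) M := Gamma (hb_delta HB) (hb_lam1 HB) psi1 psi2.

Record IsBraceModule (HB : HopfBrace) (M : C) (psi1 psi2 : Hom (HB ⊗ M) M)
    : Prop := {
  bmod_module1 : IsModule (A := hb_H1 HB) psi1;
  bmod_module2 : IsModule (A := hb_H2 HB) psi2;
  bmod_compat : psi2 ∘ (idm HB ⊠ psi1)
    = psi1 ∘ (hb_mu2 HB ⊠ Gamma_mod psi1 psi2) ∘ mid HB HB HB M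
      ∘ (hb_delta HB ⊠ idm (HB ⊗ M))
}.

Record BraceModule (HB : HopfBrace) := {
  bm_ob : C;
  bm_psi1 : Hom (HB ⊗ bm_ob) bm_ob;
  bm_psi2 : Hom (HB ⊗ bm_ob) bm_ob;
  bm_ax : IsBraceModule bm_psi1 bm_psi2
}.

Record BraceModuleHom (HB : HopfBrace) (M N : BraceModule HB) := {
  bmh : Hom (bm_ob M) (bm_ob N);
  bmh_mod1 : IsModuleMorphism (A := hb_H1 HB) (bm_psi1 M) (bm_psi1 N) bmh;
  bmh_mod2 : IsModuleMorphism (A := hb_H2 HB) (bm_psi2 M) (bm_psi2 N) bmh
}.

Record IsInvertibleCocycle (A H : HopfAlgebra) (phi : Hom (A ⊗ H) H)
    (pi : Hom A H) : Prop := {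
  cocycle_modalg : IsModuleAlgebra (ha_eta H) (ha_mu H) phi;
  cocycle_coalg :
    IsCoalgebraMorphism (ha_eps A) (ha_delta A) (ha_eps H) (ha_delta H) pi;
  cocycle_iso : is_iso pi;
  cocycle_mul : pi ∘ ha_mu A
    = ha_mu H ∘ (pi ⊠ phi) ∘ asc A A H ∘ (ha_delta A ⊠ pi)
}.

Record InvertibleCocycle := {
  ic_A : HopfAlgebra;
  ic_H : HopfAlgebra;
  ic_phi : Hom (ic_A ⊗ ic_H) ic_H;
  ic_pi : Hom ic_A ic_H;
  ic_ax : IsInvertibleCocycle ic_phi ic_pi
}.

Record IsCocycleModule (p : InvertibleCocycle) (M N : C)
    (phiM : Hom (ic_A p ⊗ M) M) (varphiM : Hom (ic_H p ⊗ M) M)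
    (phiN : Hom (ic_A p ⊗ N) N) (gamma : Hom N M) : Prop := {
  cmod_phiM : IsModule phiM;
  cmod_varphiM : IsModule varphiM;
  cmod_compat : phiM ∘ (idm (ic_A p) ⊠ varphiM)
    = varphiM ∘ (ic_phi p ⊠ phiM) ∘ mid (ic_A p) (ic_A p) (ic_H p) M
      ∘ (ha_delta (ic_A p) ⊠ idm (ic_H p ⊗ M));
  cmod_phiN : IsModule phiN;
  cmod_iso : is_iso gamma;
  cmod_gamma : gamma ∘ phiN
    = varphiM ∘ (ic_pi p ⊠ phiM) ∘ asc (ic_A p) (ic_A p) M
      ∘ (ha_delta (ic_A p) ⊠ gamma)
}.

Record CocycleModule (p : InvertibleCocycle) := {
  cm_M : C;
  cm_N : C;
  cm_phiM : Hom (ic_A p ⊗ cm_M) cm_M;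
  cm_varphiM : Hom (ic_H p ⊗ cm_M) cm_M;
  cm_phiN : Hom (ic_A p ⊗ cm_N) cm_N;
  cm_gamma : Hom cm_N cm_M;
  cm_ax : IsCocycleModule cm_phiM cm_varphiM cm_phiN cm_gamma
}.

Record IsCocycleModuleHom (p : InvertibleCocycle) (X Y : CocycleModule p)
    (h : Hom (cm_M X) (cm_M Y)) (l : Hom (cm_N X) (cm_N Y)) : Prop := {
  cmhom_phiM : IsModuleMorphism (cm_phiM X) (cm_phiM Y) h;
  cmhom_varphiM : IsModuleMorphism (cm_varphiM X) (cm_varphiM Y) h;
  cmhom_phiN : IsModuleMorphism (cm_phiN X) (cm_phiN Y) l;
  cmhom_gamma : h ∘ cm_gamma X = cm_gamma Y ∘ l
}.

Record CocycleModuleHom (p : InvertibleCocycle) (X Y : CocycleModule p) := {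
  cmh_h : Hom (cm_M X) (cm_M Y);
  cmh_l : Hom (cm_N X) (cm_N Y);
  cmh_ax : IsCocycleModuleHom cmh_h cmh_l
}.

Lemma IsModuleMorphism_id (A : HopfAlgebra) (M : C) (phi : Hom (A ⊗ M) M) :
  IsModuleMorphism phi phi (idm M).
Proof.
unfold IsModuleMorphism. now rewrite tensm_id, comp_idl, comp_idr.
Qed.

Lemma IsModuleMorphism_comp (A : HopfAlgebra) (M N P : C)
    (phiM : Hom (A ⊗ M) M) (phiN : Hom (A ⊗ N) N) (phiP : Hom (A ⊗ P) P)
    (g : Hom N P) (f : Hom M N) :
  IsModuleMorphism phiN phiP g -> IsModuleMorphism phiM phiN f ->
  IsModuleMorphism phiM phiP (g ∘ f).
Proof.
unfold IsModuleMorphism; intros Hg Hf.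
rewrite <- comp_assoc, Hf, comp_assoc, Hg, <- comp_assoc, <- tensm_comp.
now rewrite comp_idl.
Qed.

Lemma BraceModuleHom_eq (HB : HopfBrace) (M N : BraceModule HB)
    (f g : BraceModuleHom M N) : bmh f = bmh g -> f = g.
Proof.
destruct f as [f f1 f2], g as [g g1 g2]; simpl; intros ->.
now rewrite (proof_irrelevance _ f1 g1), (proof_irrelevance _ f2 g2).
Qed.

Lemma CocycleModuleHom_eq (p : InvertibleCocycle) (X Y : CocycleModule p)
    (f g : CocycleModuleHom X Y) :
  cmh_h f = cmh_h g -> cmh_l f = cmh_l g -> f = g.
Proof.
destruct f as [fh fl fx], g as [gh gl gx]; simpl; intros -> ->.
now rewrite (proof_irrelevance _ fx gx).
Qed.

Definition brace_mod_id (HB : HopfBrace) (M : BraceModule HB)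
  : BraceModuleHom M M :=
  {| bmh := idm (bm_ob M);
     bmh_mod1 := IsModuleMorphism_id (A := hb_H1 HB) (bm_psi1 M);
     bmh_mod2 := IsModuleMorphism_id (A := hb_H2 HB) (bm_psi2 M) |}.

Definition brace_mod_comp (HB : HopfBrace) (M N P : BraceModule HB)
    (g : BraceModuleHom N P) (f : BraceModuleHom M N) : BraceModuleHom M P :=
  {| bmh := bmh g ∘ bmh f;
     bmh_mod1 := IsModuleMorphism_comp (bmh_mod1 g) (bmh_mod1 f);
     bmh_mod2 := IsModuleMorphism_comp (bmh_mod2 g) (bmh_mod2 f) |}.

Definition BraceMod (HB : HopfBrace) : Category.
Proof.
refine {| Ob := BraceModule HB;
          Hom := @BraceModuleHom HB;
          idm := @brace_mod_id HB;
          comp := @brace_mod_comp HB |}.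
- intros A B f; apply BraceModuleHom_eq, comp_idl.
- intros A B f; apply BraceModuleHom_eq, comp_idr.
- intros A B D E h g f; apply BraceModuleHom_eq, comp_assoc.
Defined.

Lemma IsCocycleModuleHom_id (p : InvertibleCocycle) (X : CocycleModule p) :
  IsCocycleModuleHom (X := X) (Y := X) (idm (cm_M X)) (idm (cm_N X)).
Proof.
split; try apply IsModuleMorphism_id. now rewrite comp_idl, comp_idr.
Qed.

Lemma IsCocycleModuleHom_comp (p : InvertibleCocycle)
    (X Y Z : CocycleModule p)
    (g : CocycleModuleHom Y Z) (f : CocycleModuleHom X Y) :
  IsCocycleModuleHom (X := X) (Y := Z) (cmh_h g ∘ cmh_h f) (cmh_l g ∘ cmh_l f).
Proof.
destruct (cmh_ax g) as [g1 g2 g3 g4], (cmh_ax f) as [f1 f2 f3 f4].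
split; try (eapply IsModuleMorphism_comp; eassumption).
now rewrite <- comp_assoc, f4, comp_assoc, g4, comp_assoc.
Qed.

Definition cocycle_mod_id (p : InvertibleCocycle) (X : CocycleModule p)
  : CocycleModuleHom X X :=
  {| cmh_ax := IsCocycleModuleHom_id X |}.

Definition cocycle_mod_comp (p : InvertibleCocycle) (X Y Z : CocycleModule p)
    (g : CocycleModuleHom Y Z) (f : CocycleModuleHom X Y)
  : CocycleModuleHom X Z :=
  {| cmh_ax := IsCocycleModuleHom_comp g f |}.

Definition CocycleMod (p : InvertibleCocycle) : Category.
Proof.
refine {| Ob := CocycleModule p;
          Hom := @CocycleModuleHom p;
          idm := @cocycle_mod_id p;
          comp := @cocycle_mod_comp p |}.
- intros A B f; apply CocycleModuleHom_eq; apply comp_idl.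
- intros A B f; apply CocycleModuleHom_eq; apply comp_idr.
- intros A B D E h g f; apply CocycleModuleHom_eq; apply comp_assoc.
Defined.

End Algebra.

(* Main.v *)
From Stdlib Require Import ProofIrrelevance.
Require Import Defs.

Set Implicit Arguments.
Unset Strict Implicit.

(** In Sweedler notation write [a.b] and [a.m] for the first product and
    action, [a*b] and [a*m] for the second, and [S] for the antipode of [H_1],
    so that [Γ(h, m) = S(h1).(h2*m)].  Four facts give the whole theorem.

    - [h*m = h1.Γ(h2, m)], because [h1.S(h2) = ε(h)1].  This is the cocycle
      identity for [id_H] and the condition on [γ = id_M].
    - [Γ(h, g.m) = Γ(h1, g).Γ(h2, m)]: inside [S(h1).(h2*(g.m))] the
      compatibility of the brace module turns [h2*(g.m)] into
      [(h2*g).S(h3).(h4*m)].  This is the compatibility of the two actions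
      on [M], and the multiplicativity of [Γ] on [H].
    - [Γ(h, Γ(g, m)) = Γ(h*g, m)]: both sides [t(h, g, m)] solve
      [(h1*g1).t(h2, g2, m) = h*(g*m)], and [t] can be recovered from the left
      side, since [h*g] has the convolution inverse [S(h*g)] on the coalgebra
      [H ⊗ H] ([mul2_act_injective]).
    - The two units agree ([unit2_eq_unit1]), which makes [Γ] unital and
      compatible with the unit of [H_1].

    Since [H] with its two products is itself a module over the brace
    ([regular_module]), the statements about [H] are instances of those
    about [M].  Functoriality is then immediate, morphisms being equal
    when their components are.

    Reassociations are the only obstacle to writing these computations down,
    as [(A ⊗ B) ⊗ D] and [A ⊗ (B ⊗ D)] are equal but not convertible.  They
    disappear when every structure map acts on the head of a right-nested
    product [A ⊗ (B ⊗ ... ⊗ X)], for an arbitrary tail [X]: whiskering on the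
    right is then the choice of another tail, and sliding two maps past each
    other is naturality in the tail.  The axioms are first transported to
    these lifted maps; the computations with them contain no associator. *)

Notation "A ◁ f" := (idm A ⊠ f) (at level 34, right associativity) : cat_scope.
Notation "f ▷ X" := (f ⊠ idm X) (at level 34, no associativity) : cat_scope.

(** * Rewriting inside composites *)

Section Rewriting.
Variable C : Category.

(** With a formal argument [z] at the right end, composites nested to the right
    read like applications of functions, and an equation between short
    composites can be rewritten anywhere inside. *)
Lemma hom_ext (A B : C) (f g : Hom A B) :
  (forall (Z : C) (z : Hom Z A), f ∘ z = g ∘ z) -> f = g.
Proof. intros e. now rewrite <- (comp_idr f), <- (comp_idr g). Qed.

Lemma tail2 (A B D : C) (f : Hom B D) (g : Hom A B) (t : Hom A D)
    (e : f ∘ g = t) (Z : C) (z : Hom Z A) : f ∘ (g ∘ z) = t ∘ z.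
Proof. now rewrite comp_assoc, e. Qed.

Lemma tail3 (A B D E : C) (f : Hom D E) (g : Hom B D) (h : Hom A B)
    (t : Hom A E) (e : f ∘ g ∘ h = t) (Z : C) (z : Hom Z A) :
  f ∘ (g ∘ (h ∘ z)) = t ∘ z.
Proof. now rewrite !comp_assoc, e. Qed.

Lemma eqhom_comp (A B D : C) (p : A = B) (q : B = D) :
  eqhom q ∘ eqhom p = eqhom (eq_trans p q).
Proof. destruct q; apply comp_idl. Qed.

Lemma eqhom_loop (A : C) (p : A = A) : eqhom p = idm A.
Proof. now rewrite (proof_irrelevance _ p eq_refl). Qed.

(** Two composites through the same maps [f] and [g] are compared by comparing
    the reassociations between them. *)
Lemma comp_congr3 (A B D E F G : C) (f : Hom B D) (g : Hom E F)
    (p p' : Hom A B) (q q' : Hom D E) (r r' : Hom F G) :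
  r = r' -> q = q' -> p = p' ->
  r ∘ g ∘ q ∘ f ∘ p = r' ∘ g ∘ q' ∘ f ∘ p'.
Proof. now intros -> -> ->. Qed.
End Rewriting.

(** * Strict coherence and lifted maps *)

Section Coherence.
Variable C : StrictMonoidalCategory.

Lemma whisker_eqhom (A B D : C) (p : B = D) :
  A ◁ eqhom p = eqhom (f_equal (fun X => A ⊗ X) p).
Proof. destruct p; apply tensm_id. Qed.

Lemma eqhom_whisker (A B D : C) (p : B = D) :
  eqhom p ▷ A = eqhom (f_equal (fun X => X ⊗ A) p).
Proof. destruct p; apply tensm_id. Qed.

Lemma whisker_comp (A B D E : C) (g : Hom D E) (f : Hom B D) :
  A ◁ (g ∘ f) = (A ◁ g) ∘ (A ◁ f).
Proof. rewrite <- tensm_comp, comp_idl. reflexivity. Qed.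

Lemma comp_whisker (A B D E : C) (g : Hom D E) (f : Hom B D) :
  (g ∘ f) ▷ A = (g ▷ A) ∘ (f ▷ A).
Proof. rewrite <- tensm_comp, comp_idl. reflexivity. Qed.

Lemma interchange (A A' B B' : C) (f : Hom A A') (g : Hom B B') :
  (f ▷ B') ∘ (A ◁ g) = (A' ◁ g) ∘ (f ▷ B).
Proof. now rewrite <- !tensm_comp, !comp_idl, !comp_idr. Qed.

Lemma tensm_split (A A' B B' : C) (f : Hom A A') (g : Hom B B') :
  f ⊠ g = (f ▷ B') ∘ (A ◁ g).
Proof. now rewrite <- tensm_comp, comp_idl, comp_idr. Qed.

Lemma whisker2 (P A B D : C) (f : Hom B D) (g : Hom A B) (t : Hom A D)
    (e : f ∘ g = t) : (P ◁ f) ∘ (P ◁ g) = P ◁ t.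
Proof. now rewrite <- whisker_comp, e. Qed.

Lemma asc_asci (A B D : C) : asc A B D ∘ asci A B D = idm (A ⊗ B ⊗ D).
Proof. unfold asc, asci. now rewrite eqhom_comp, eqhom_loop. Qed.

Lemma asci_asc (A B D : C) : asci A B D ∘ asc A B D = idm ((A ⊗ B) ⊗ D).
Proof. unfold asc, asci. now rewrite eqhom_comp, eqhom_loop. Qed.

Lemma asci_nat (A A' B B' D D' : C)
    (f : Hom A A') (g : Hom B B') (h : Hom D D') :
  asci A' B' D' ∘ (f ⊠ g ⊠ h) = ((f ⊠ g) ⊠ h) ∘ asci A B D.
Proof.
rewrite <- (comp_idr (f ⊠ g ⊠ h)), <- (asc_asci A B D).
rewrite (comp_assoc (f ⊠ g ⊠ h)). unfold asc at 1. rewrite <- tensm_assoc.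
rewrite !comp_assoc. fold (asc A' B' D'). now rewrite asci_asc, comp_idl.
Qed.

Lemma asc_nat (A A' B B' D D' : C)
    (f : Hom A A') (g : Hom B B') (h : Hom D D') :
  asc A' B' D' ∘ ((f ⊠ g) ⊠ h) = (f ⊠ g ⊠ h) ∘ asc A B D.
Proof. apply tensm_assoc. Qed.

Lemma asc_whisker (A B X X' : C) (h : Hom X X') :
  asc A B X' ∘ ((A ⊗ B) ◁ h) = (A ◁ B ◁ h) ∘ asc A B X.
Proof. rewrite <- asc_nat, tensm_id. reflexivity. Qed.

Lemma asci_whisker (A B X X' : C) (h : Hom X X') :
  asci A B X' ∘ (A ◁ B ◁ h) = ((A ⊗ B) ◁ h) ∘ asci A B X.
Proof. rewrite asci_nat, tensm_id. reflexivity. Qed.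

Lemma lu_nat (X Y : C) (f : Hom X Y) : lu Y ∘ (K ◁ f) = f ∘ lu X.
Proof. apply tensm_unitl. Qed.

Lemma lu_lui (A : C) : lu A ∘ lui A = idm A.
Proof. unfold lu, lui. now rewrite eqhom_comp, eqhom_loop. Qed.

Lemma lui_lu (A : C) : lui A ∘ lu A = idm (K ⊗ A).
Proof. unfold lu, lui. now rewrite eqhom_comp, eqhom_loop. Qed.

Lemma lui_nat (X Y : C) (f : Hom X Y) : lui Y ∘ f = (K ◁ f) ∘ lui X.
Proof.
transitivity (lui Y ∘ (lu Y ∘ (K ◁ f) ∘ lui X)).
- now rewrite lu_nat, <- comp_assoc, lu_lui, comp_idr.
- now rewrite !comp_assoc, lui_lu, comp_idl.
Qed.

(** [liftij f X] is [f ⊗ X], for [f] with [i] tensor factors in its source and [j]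
    in its target, reassociated so that source and target are nested to the
    right and the unit object is absent. *)
Definition lift21 (A B D : C) (f : Hom (A ⊗ B) D) (X : C)
  : Hom (A ⊗ B ⊗ X) (D ⊗ X) := (f ▷ X) ∘ asci A B X.
Definition lift12 (A B D : C) (f : Hom A (B ⊗ D)) (X : C)
  : Hom (A ⊗ X) (B ⊗ D ⊗ X) := asc B D X ∘ (f ▷ X).
Definition lift01 (A : C) (f : Hom K A) (X : C) : Hom X (A ⊗ X) :=
  (f ▷ X) ∘ lui X.
Definition lift10 (A : C) (f : Hom A K) (X : C) : Hom (A ⊗ X) X :=
  lu X ∘ (f ▷ X).

End Coherence.

Ltac rassoc := rewrite <- ?comp_assoc.
Ltac flat := repeat progress (rewrite ?whisker_comp, <- ?comp_assoc).
Ltac pointwise := apply hom_ext; intros ? ?; flat.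

Ltac rewrite2 e := rewrite (tail2 e); flat.
Ltac rewrite3 e := rewrite (tail3 e); flat.
Ltac rewrite2_rev e := rewrite (tail2 (eq_sym e)); flat.

(** Every reassociation is the identity along an equality of objects, so by
    proof irrelevance two parallel composites of reassociations are equal. *)
Ltac coh :=
  unfold asc, asci, lu, lui, ru, rui;
  repeat progress (rewrite ?whisker_eqhom, ?eqhom_whisker, ?eqhom_comp,
     ?comp_idl, ?comp_idr);
  first [ apply eqhom_loop | symmetry; apply eqhom_loop
        | f_equal; apply proof_irrelevance ].

(** * Structure maps acting on the head of a product *)

Section Lifts.
Variable C : StrictMonoidalCategory.

Lemma pentagon (A B D E : C) :
  (A ◁ asc B D E) ∘ asc A (B ⊗ D) E ∘ (asc A B D ▷ E)
  = asc A B (D ⊗ E) ∘ asc (A ⊗ B) D E.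
Proof. coh. Qed.

Lemma lift21_nat (A B D : C) (f : Hom (A ⊗ B) D) (X Y : C) (h : Hom X Y) :
  lift21 f Y ∘ (A ◁ B ◁ h) = (D ◁ h) ∘ lift21 f X.
Proof.
unfold lift21. pointwise. rewrite2 (asci_whisker A B h). now rewrite2 (interchange f h).
Qed.

Lemma lift12_nat (A B D : C) (f : Hom A (B ⊗ D)) (X Y : C) (h : Hom X Y) :
  lift12 f Y ∘ (A ◁ h) = (B ◁ D ◁ h) ∘ lift12 f X.
Proof.
unfold lift12. pointwise. rewrite2 (interchange f h). now rewrite2 (asc_whisker B D h).
Qed.

Lemma lift01_nat (A : C) (f : Hom K A) (X Y : C) (h : Hom X Y) :
  lift01 f Y ∘ h = (A ◁ h) ∘ lift01 f X.
Proof.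
unfold lift01. pointwise. rewrite2 (lui_nat h). now rewrite2 (interchange f h).
Qed.

Lemma lift10_nat (A : C) (f : Hom A K) (X Y : C) (h : Hom X Y) :
  lift10 f Y ∘ (A ◁ h) = h ∘ lift10 f X.
Proof.
unfold lift10. pointwise. rewrite2 (interchange f h). now rewrite2 (lu_nat h).
Qed.

Lemma tensm_lift21 (A B D X Y : C) (f : Hom (A ⊗ B) D) (g : Hom X Y) :
  (f ⊠ g) ∘ asci A B X = lift21 f Y ∘ (A ◁ B ◁ g).
Proof.
unfold lift21. rewrite tensm_split. pointwise. now rewrite2 (asci_whisker A B g).
Qed.

Lemma lift12_whisker (P A B D X : C) (f : Hom A (B ⊗ D)) :
  (P ◁ lift12 f X) ∘ asc P A X
  = (P ◁ asc B D X) ∘ asc P (B ⊗ D) X ∘ ((P ◁ f) ▷ X).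
Proof.
unfold lift12. pointwise. now rewrite2 (asc_nat (idm P) f (idm X)).
Qed.

Lemma lift12_coassoc (A : C) (delta : Hom A (A ⊗ A))
  (e : asc A A A ∘ (delta ▷ A) ∘ delta = (A ◁ delta) ∘ delta) (X : C) :
  lift12 delta (A ⊗ X) ∘ lift12 delta X = (A ◁ lift12 delta X) ∘ lift12 delta X.
Proof.
transitivity (asc A A (A ⊗ X) ∘ asc (A ⊗ A) A X ∘ (((delta ▷ A) ∘ delta) ▷ X)).
- unfold lift12. rewrite comp_whisker, <- (tensm_id A X). pointwise.
  now rewrite2 (asc_nat delta (idm A) (idm X)).
- rewrite <- pentagon.
  transitivity ((A ◁ asc A A X) ∘ asc A (A ⊗ A) X
    ∘ ((asc A A A ∘ (delta ▷ A) ∘ delta) ▷ X)).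
  + rewrite !comp_whisker. now pointwise.
  + rewrite e, comp_whisker. unfold lift12 at 2. pointwise.
    now rewrite2 (lift12_whisker A X delta).
Qed.

Lemma lift21_assoc (A M : C) (mu : Hom (A ⊗ A) A) (psi : Hom (A ⊗ M) M) :
  psi ∘ (A ◁ psi) ∘ asc A A M = psi ∘ (mu ▷ M) ->
  psi ∘ (A ◁ psi) = psi ∘ lift21 mu M.
Proof.
intros e. unfold lift21. rewrite comp_assoc, <- e. pointwise.
now rewrite (tail2 (asc_asci A A M)), comp_idl.
Qed.

Lemma lift21_lift01 (A M X : C) (eta : Hom K A) (mu : Hom (A ⊗ M) M) :
  mu ∘ (eta ▷ M) = lu M -> lift21 mu X ∘ lift01 eta (M ⊗ X) = idm (M ⊗ X).
Proof.
intros e. unfold lift21, lift01.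
transitivity (((mu ∘ (eta ▷ M)) ▷ X) ∘ (asci K M X ∘ lui (M ⊗ X))).
- rewrite comp_whisker, <- (tensm_id M X). pointwise.
  now rewrite2 (asci_nat eta (idm M) (idm X)).
- rewrite e. coh.
Qed.

Lemma lift10_lift12 (A X : C) (eps : Hom A K) (delta : Hom A (A ⊗ A)) :
  (eps ▷ A) ∘ delta = lui A -> lift10 eps (A ⊗ X) ∘ lift12 delta X = idm (A ⊗ X).
Proof.
intros e. unfold lift12, lift10.
transitivity ((lu (A ⊗ X) ∘ asc K A X) ∘ (((eps ▷ A) ∘ delta) ▷ X)).
- rewrite comp_whisker, <- (tensm_id A X). pointwise.
  now rewrite2 (asc_nat eps (idm A) (idm X)).
- rewrite e. coh.
Qed.

Lemma lift12_lift01 (A X : C) (eta : Hom K A) (delta : Hom A (A ⊗ A)) :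
  delta ∘ eta = (eta ⊠ eta) ∘ lui K ->
  lift12 delta X ∘ lift01 eta X = lift01 eta (A ⊗ X) ∘ lift01 eta X.
Proof.
intros e. unfold lift12, lift01.
transitivity (asc A A X ∘ ((delta ∘ eta) ▷ X) ∘ lui X).
- rewrite comp_whisker. now pointwise.
- rewrite e, comp_whisker.
  transitivity ((eta ⊠ (eta ▷ X)) ∘ (asc K K X ∘ (lui K ▷ X) ∘ lui X)).
  + pointwise. now rewrite2 (asc_nat eta eta (idm X)).
  + rewrite (tensm_split eta). pointwise.
    rewrite2 (lui_nat (eta ▷ X)). do 2 f_equal.
    assert (E : asc K K X ∘ (lui K ▷ X) ∘ lui X = lui (K ⊗ X) ∘ lui X) by coh.
    rewrite3 E. reflexivity.
Qed.

Lemma lift10_lift21 (A X : C) (eps : Hom A K) (mu : Hom (A ⊗ A) A) :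
  eps ∘ mu = lu K ∘ (eps ⊠ eps) ->
  lift10 eps X ∘ lift21 mu X = lift10 eps X ∘ lift10 eps (A ⊗ X).
Proof.
intros e. unfold lift10, lift21.
transitivity (lu X ∘ ((eps ∘ mu) ▷ X) ∘ asci A A X).
- rewrite comp_whisker. now pointwise.
- rewrite e, comp_whisker.
  transitivity (lu X ∘ (lu K ▷ X) ∘ asci K K X ∘ (eps ⊠ (eps ▷ X))).
  + pointwise. now rewrite2 (asci_nat eps eps (idm X)).
  + assert (E : lu X ∘ (lu K ▷ X) ∘ asci K K X = lu X ∘ lu (K ⊗ X)) by coh.
    rewrite E.
    rewrite (tensm_split eps (eps ▷ X)), (interchange eps).
    pointwise. now rewrite2 (lu_nat (eps ▷ X)).
Qed.

(** Convolution products survive the lift, so the antipode identities do. *)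
Lemma lift21_convolution (A X : C) (delta : Hom A (A ⊗ A)) (mu : Hom (A ⊗ A) A)
    (f g : Hom A A) :
  lift21 mu X ∘ (f ▷ (A ⊗ X)) ∘ (A ◁ (g ▷ X)) ∘ lift12 delta X
  = (mu ∘ (f ⊠ g) ∘ delta) ▷ X.
Proof.
unfold lift21, lift12. rewrite !comp_whisker.
transitivity ((mu ▷ X) ∘ asci A A X ∘ (f ⊠ (g ▷ X)) ∘ asc A A X ∘ (delta ▷ X)).
- rewrite (tensm_split f (g ▷ X)). now pointwise.
- pointwise. rewrite2 (asci_nat f g (idm X)). now rewrite (tail2 (asci_asc A A X)), comp_idl.
Qed.

Lemma lift01_lift10 (A X : C) (eta : Hom K A) (eps : Hom A K) :
  lift01 eta X ∘ lift10 eps X = (eta ∘ eps) ▷ X.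
Proof.
unfold lift01, lift10. rewrite comp_whisker. pointwise.
now rewrite (tail2 (lui_lu X)), comp_idl.
Qed.

Lemma antipodel_lift (A X : C) (eta : Hom K A) (eps : Hom A K)
    (delta : Hom A (A ⊗ A)) (mu : Hom (A ⊗ A) A) (lam : Hom A A) :
  mu ∘ (lam ⊠ idm A) ∘ delta = eta ∘ eps ->
  lift21 mu X ∘ (lam ▷ (A ⊗ X)) ∘ lift12 delta X = lift01 eta X ∘ lift10 eps X.
Proof.
intros e. rewrite lift01_lift10, <- e.
rewrite <- lift21_convolution, !tensm_id, comp_idr. reflexivity.
Qed.

Lemma antipoder_lift (A X : C) (eta : Hom K A) (eps : Hom A K)
    (delta : Hom A (A ⊗ A)) (mu : Hom (A ⊗ A) A) (lam : Hom A A) :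
  mu ∘ (idm A ⊠ lam) ∘ delta = eta ∘ eps ->
  lift21 mu X ∘ (A ◁ (lam ▷ X)) ∘ lift12 delta X = lift01 eta X ∘ lift10 eps X.
Proof.
intros e. rewrite lift01_lift10, <- e.
rewrite <- lift21_convolution, !tensm_id, comp_idr. reflexivity.
Qed.

(** Lifting twice is lifting once with the longer tail; with [lift12_tail],
    [whisker_tail] and [swap_tail] this transports a composite of lifted maps
    to any tail. *)
Lemma lift21_tail (A B D : C) (f : Hom (A ⊗ B) D) (Y X : C) :
  lift21 f Y ▷ X
  = asci D Y X ∘ lift21 f (Y ⊗ X) ∘ (A ◁ asc B Y X) ∘ asc A (B ⊗ Y) X.
Proof.
transitivity (asci D Y X ∘ (f ▷ (Y ⊗ X)) ∘ (asc (A ⊗ B) Y X ∘ (asci A B Y ▷ X))).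
- unfold lift21. rewrite comp_whisker, <- (tensm_id Y X). pointwise.
  rewrite2 (asci_nat f (idm Y) (idm X)).
  now rewrite (tail2 (asci_asc (A ⊗ B) Y X)), comp_idl.
- unfold lift21. rassoc. do 2 f_equal. coh.
Qed.

Lemma lift12_tail (A B D : C) (f : Hom A (B ⊗ D)) (Y X : C) :
  lift12 f Y ▷ X
  = asci B (D ⊗ Y) X ∘ (B ◁ asci D Y X) ∘ lift12 f (Y ⊗ X) ∘ asc A Y X.
Proof.
transitivity ((asc B D Y ▷ X) ∘ asci (B ⊗ D) Y X ∘ (f ▷ (Y ⊗ X)) ∘ asc A Y X).
- unfold lift12. rewrite comp_whisker, <- (tensm_id Y X). pointwise.
  rewrite2 (asci_nat f (idm Y) (idm X)).
  now rewrite (tail2 (asci_asc A Y X)), comp_idl.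
- unfold lift12. rewrite !comp_assoc. do 2 f_equal. coh.
Qed.

Lemma whisker_tail (A B D X : C) (g : Hom B D) :
  (A ◁ g) ▷ X = asci A D X ∘ (A ◁ (g ▷ X)) ∘ asc A B X.
Proof.
pointwise. rewrite2 (asci_nat (idm A) g (idm X)).
now rewrite (tail2 (asci_asc A B X)), comp_idl.
Qed.

Lemma lift21_asc (A B D : C) (f : Hom (A ⊗ B) D) (X : C) :
  f ▷ X = lift21 f X ∘ asc A B X.
Proof. unfold lift21. pointwise. now rewrite (tail2 (asci_asc A B X)), comp_idl. Qed.

Lemma lift12_asci (A B D : C) (f : Hom A (B ⊗ D)) (X : C) :
  f ▷ X = asci B D X ∘ lift12 f X.
Proof. unfold lift12. pointwise. now rewrite (tail2 (asci_asc B D X)), comp_idl. Qed.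

Lemma lift01_act (A M : C) (eta : Hom K A) (psi : Hom (A ⊗ M) M) :
  psi ∘ (eta ▷ M) = lu M -> psi ∘ lift01 eta M = idm M.
Proof. intros e. unfold lift01. now rewrite comp_assoc, e, lu_lui. Qed.

Lemma lift01_lu (A X : C) (eta : Hom K A) : lift01 eta X ∘ lu X = eta ▷ X.
Proof. unfold lift01. now rewrite <- comp_assoc, lui_lu, comp_idr. Qed.

Lemma ru_nat (X Y : C) (f : Hom X Y) : ru Y ∘ (f ▷ K) = f ∘ ru X.
Proof. apply tensm_unitr. Qed.

Lemma ru_lift01 (A : C) (u : Hom K A) : ru A ∘ lift01 u K = u.
Proof.
unfold lift01. rewrite comp_assoc, ru_nat, <- comp_assoc.
assert (E : ru K ∘ lui K = idm (K : C)) by coh.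
now rewrite E, comp_idr.
Qed.

Lemma lift01_comp (A B X : C) (f : Hom A B) (u : Hom K A) :
  (f ▷ X) ∘ lift01 u X = lift01 (f ∘ u) X.
Proof. unfold lift01. rewrite comp_whisker. now rassoc. Qed.

Lemma lift12_ru (A B D : C) (d : Hom A (B ⊗ D)) : (B ◁ ru D) ∘ lift12 d K = d ∘ ru A.
Proof.
unfold lift12. rewrite <- ru_nat, comp_assoc. f_equal. coh.
Qed.

Lemma lu_tensm_unit (A B : C) (e : Hom A K) (u : Hom K B) :
  lu B ∘ (e ⊠ u) = u ∘ e ∘ ru A.
Proof.
rewrite tensm_split, interchange, comp_assoc, lu_nat.
assert (E : lu K = ru (K : C)) by coh.
rewrite E. rassoc. now rewrite ru_nat.
Qed.

(** [Γ] of an algebra acting on itself is a composite of lifted maps for every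
    tail, so it can be unfolded in front of a further factor [X]. *)
Lemma lift21_Gamma (A X : C) (lam : Hom A A) (m1 m2 : Hom (A ⊗ A) A) (d : Hom A (A ⊗ A)) :
  lift21 (m1 ∘ (lam ⊠ m2) ∘ asc A A A ∘ (d ▷ A)) X
  = lift21 m1 X ∘ (lam ▷ (A ⊗ X)) ∘ (A ◁ lift21 m2 X) ∘ lift12 d (A ⊗ X).
Proof.
transitivity (((m1 ∘ (lam ▷ A) ∘ (A ◁ m2) ∘ lift12 d A) ▷ X) ∘ asci A A X).
{ unfold lift21, lift12. rewrite (tensm_split lam m2). flat. reflexivity. }
rewrite !comp_whisker, lift12_tail, whisker_tail, (lift21_asc m1), (lift21_asc m2).
pointwise. rewrite (tail2 (asc_asci A A X)), comp_idl.
rewrite (tail2 (asc_asci A (A ⊗ A) X)), comp_idl.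
rewrite (tail2 (whisker2 A (asc_asci A A X))), tensm_id, comp_idl.
rewrite <- (tensm_id A X). rewrite2 (asc_nat lam (idm A) (idm X)).
now rewrite (tail2 (asc_asci A A X)), comp_idl.
Qed.
End Lifts.

(** * The braiding acting on the head of a product *)

Section Braid.
Variable C : StrictBraidedCategory.

Definition swap (A B X : C) : Hom (A ⊗ B ⊗ X) (B ⊗ A ⊗ X) :=
  asc B A X ∘ (braid A B ▷ X) ∘ asci A B X.

Lemma swap_nat (A B X Y : C) (h : Hom X Y) :
  swap A B Y ∘ (A ◁ B ◁ h) = (B ◁ A ◁ h) ∘ swap A B X.
Proof.
unfold swap. pointwise. rewrite2 (asci_whisker A B h). rewrite2 (interchange (braid A B) h).
now rewrite2 (asc_whisker B A h).
Qed.

Lemma swap_nat1 (A A' B X : C) (f : Hom A A') :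
  swap A' B X ∘ (f ▷ (B ⊗ X)) = (B ◁ (f ▷ X)) ∘ swap A B X.
Proof.
unfold swap. rewrite <- (tensm_id B X). pointwise. rewrite2 (asci_nat f (idm B) (idm X)).
rewrite (tail2 (eq_sym (comp_whisker X (braid A' B) (f ▷ B)))), braid_nat, comp_whisker.
flat. now rewrite2 (asc_nat (idm B) f (idm X)).
Qed.

Lemma swap_nat2 (A B B' X : C) (g : Hom B B') :
  swap A B' X ∘ (A ◁ (g ▷ X)) = (g ▷ (A ⊗ X)) ∘ swap A B X.
Proof.
unfold swap. rewrite <- (tensm_id A X). pointwise. rewrite2 (asci_nat (idm A) g (idm X)).
rewrite (tail2 (eq_sym (comp_whisker X (braid A B') (A ◁ g)))), braid_nat, comp_whisker.
flat. now rewrite2 (asc_nat g (idm A) (idm X)).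
Qed.

(** For lifted braidings the hexagons have no associator between the two
    crossings. *)
Lemma swap_hexl (A B D X : C) :
  (D ◁ asc A B X) ∘ swap (A ⊗ B) D X ∘ asci A B (D ⊗ X)
  = swap A D (B ⊗ X) ∘ (A ◁ swap B D X).
Proof.
unfold swap at 1. rewrite braid_hexl, !comp_whisker, (whisker_tail A X (braid B D)).
assert (E : (braid A D ▷ B) ▷ X
  = asci (D ⊗ A) B X ∘ (braid A D ▷ (B ⊗ X)) ∘ asc (A ⊗ D) B X).
{ rewrite <- (tensm_id B X). pointwise. rewrite2 (asci_nat (braid A D) (idm B) (idm X)).
  now rewrite (tail2 (asci_asc (A ⊗ D) B X)), comp_idl. }
rewrite E.
transitivity (((D ◁ asc A B X) ∘ asc D (A ⊗ B) X
    ∘ (asc D A B ▷ X) ∘ asci (D ⊗ A) B X)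
  ∘ (braid A D ▷ (B ⊗ X))
  ∘ (asc (A ⊗ D) B X ∘ (asci A D B ▷ X) ∘ asci A (D ⊗ B) X)
  ∘ (A ◁ (braid B D ▷ X))
  ∘ (asc A (B ⊗ D) X ∘ (asc A B D ▷ X) ∘ asci (A ⊗ B) D X ∘ asci A B (D ⊗ X))).
{ now pointwise. }
transitivity (asc D A (B ⊗ X) ∘ (braid A D ▷ (B ⊗ X))
  ∘ (asci A D (B ⊗ X) ∘ (A ◁ asc D B X))
  ∘ (A ◁ (braid B D ▷ X)) ∘ (A ◁ asci B D X)).
- apply comp_congr3; coh.
- unfold swap. now pointwise.
Qed.

Lemma swap_hexr (A B D X : C) :
  asc B D (A ⊗ X) ∘ swap A (B ⊗ D) X ∘ (A ◁ asci B D X)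
  = (B ◁ swap A D X) ∘ swap A B (D ⊗ X).
Proof.
unfold swap at 1. rewrite braid_hexr, !comp_whisker, (whisker_tail B X (braid A D)).
assert (E : (braid A B ▷ D) ▷ X
  = asci (B ⊗ A) D X ∘ (braid A B ▷ (D ⊗ X)) ∘ asc (A ⊗ B) D X).
{ rewrite <- (tensm_id D X). pointwise. rewrite2 (asci_nat (braid A B) (idm D) (idm X)).
  now rewrite (tail2 (asci_asc (A ⊗ B) D X)), comp_idl. }
rewrite E.
transitivity ((asc B D (A ⊗ X) ∘ asc (B ⊗ D) A X
    ∘ (asci B D A ▷ X) ∘ asci B (D ⊗ A) X)
  ∘ (B ◁ (braid A D ▷ X))
  ∘ (asc B (A ⊗ D) X ∘ (asc B A D ▷ X) ∘ asci (B ⊗ A) D X)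
  ∘ (braid A B ▷ (D ⊗ X))
  ∘ (asc (A ⊗ B) D X ∘ (asci A B D ▷ X) ∘ asci A (B ⊗ D) X
    ∘ (A ◁ asci B D X))).
{ now pointwise. }
transitivity ((B ◁ asc D A X) ∘ (B ◁ (braid A D ▷ X))
  ∘ ((B ◁ asci A D X) ∘ asc B A (D ⊗ X))
  ∘ (braid A B ▷ (D ⊗ X)) ∘ asci A B (D ⊗ X)).
- apply comp_congr3; coh.
- unfold swap. now pointwise.
Qed.

(** Naturality of the braiding moves [d] through the crossing, and a hexagon
    splits the crossing of its two outputs. *)
Lemma lift12_swap (A B D E X : C) (d : Hom B (D ⊗ E)) :
  lift12 d (A ⊗ X) ∘ swap A B X
  = (D ◁ swap A E X) ∘ swap A D (E ⊗ X) ∘ (A ◁ lift12 d X).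
Proof.
rewrite <- swap_hexr. unfold lift12. pointwise.
rewrite (tail2 (whisker2 A (asci_asc D E X))), tensm_id, comp_idl.
now rewrite2 (swap_nat2 A X d).
Qed.

Lemma swap_lift12 (A B D E X : C) (d : Hom B (D ⊗ E)) :
  (A ◁ lift12 d X) ∘ swap B A X
  = swap D A (E ⊗ X) ∘ (D ◁ swap E A X) ∘ lift12 d (A ⊗ X).
Proof.
rewrite <- swap_hexl. unfold lift12. pointwise.
rewrite (tail2 (asci_asc D E (A ⊗ X))), comp_idl.
now rewrite2 (swap_nat1 A X d).
Qed.

Lemma swap_iso (A B X : C) : is_iso (swap A B X).
Proof.
destruct (braid_iso A B) as [g [g1 g2]].
exists (asc A B X ∘ (g ▷ X) ∘ asci B A X); unfold swap; split.
- pointwise. rewrite (tail2 (asci_asc B A X)), comp_idl.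
  rewrite (tail2 (eq_sym (comp_whisker X g _))), g1, tensm_id, comp_idl.
  now rewrite (tail2 (asc_asci A B X)).
- pointwise. rewrite (tail2 (asci_asc A B X)), comp_idl.
  rewrite (tail2 (eq_sym (comp_whisker X _ g))), g2, tensm_id, comp_idl.
  now rewrite (tail2 (asc_asci B A X)).
Qed.

(** The braiding with the unit object is the identity.  The hexagon for [K ⊗ K]
    makes the endomorphism [k] of [D ⊗ X] that it induces idempotent, and [k] is
    invertible because the braiding is. *)
Lemma swap_unitl (D X : C) : (D ◁ lu X) ∘ swap K D X = lu (D ⊗ X).
Proof.
(* k is the braiding K ⊗ D -> D ⊗ K read as an endomorphism. *)
set (k := (D ◁ lu X) ∘ swap K D X ∘ lui (D ⊗ X)).
assert (kk : k ∘ k = k).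
{ unfold k.
  transitivity ((D ◁ lu X) ∘ (D ◁ (lu K ▷ X)) ∘ swap (K ⊗ K) D X
    ∘ asci K K (D ⊗ X) ∘ lui (K ⊗ D ⊗ X) ∘ lui (D ⊗ X)).
  - transitivity ((D ◁ lu X) ∘ (D ◁ lu (K ⊗ X)) ∘ (swap K D (K ⊗ X) ∘ (K ◁ swap K D X))
      ∘ lui (K ⊗ D ⊗ X) ∘ lui (D ⊗ X)).
    + pointwise. rewrite2_rev (lui_nat (swap K D X)).
      rewrite2 (lui_nat (D ◁ lu X)). rewrite2 (swap_nat K D (lu X)).
      rewrite (tail2 (whisker2 D (lu_nat (lu X)))). now flat.
    + rewrite <- swap_hexl.
      assert (E : (D ◁ lu X) ∘ (D ◁ lu (K ⊗ X)) ∘ (D ◁ asc K K X)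
        = (D ◁ lu X) ∘ (D ◁ (lu K ▷ X))) by coh.
      pointwise. now rewrite3 E.
  - pointwise. rewrite2 (eq_sym (swap_nat1 D X (lu K))).
    assert (E : (lu K ▷ (D ⊗ X)) ∘ asci K K (D ⊗ X) ∘ lui (K ⊗ D ⊗ X)
      = idm (K ⊗ D ⊗ X)) by coh.
    rewrite3 E. now rewrite comp_idl. }
assert (kid : k = idm _).
{ destruct (swap_iso K D X) as [g [g1 g2]].
  set (k' := lu (D ⊗ X) ∘ g ∘ (D ◁ lui X)).
  assert (k'k : k' ∘ k = idm _).
  { unfold k, k'. pointwise. rewrite (tail2 (whisker2 D (lui_lu X))), tensm_id, comp_idl.
    rewrite (tail2 g1), comp_idl. now rewrite (tail2 (lu_lui (D ⊗ X))). }
  rewrite <- (comp_idl k), <- k'k, <- comp_assoc, kk. exact eq_refl. }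
rewrite <- (comp_idl (lu (D ⊗ X))), <- kid. unfold k. pointwise.
now rewrite (tail2 (lui_lu (D ⊗ X))), comp_idl.
Qed.

Lemma swap_unitr (D X : C) : lu (D ⊗ X) ∘ swap D K X = D ◁ lu X.
Proof.
set (k := lu (D ⊗ X) ∘ swap D K X ∘ (D ◁ lui X)).
assert (kk : k ∘ k = k).
{ unfold k.
  transitivity (lu (D ⊗ X) ∘ (lu K ▷ (D ⊗ X)) ∘ swap D (K ⊗ K) X
    ∘ (D ◁ asci K K X) ∘ (D ◁ lui (K ⊗ X)) ∘ (D ◁ lui X)).
  - transitivity (lu (D ⊗ X) ∘ lu (K ⊗ D ⊗ X) ∘ ((K ◁ swap D K X) ∘ swap D K (K ⊗ X))
      ∘ (D ◁ lui (K ⊗ X)) ∘ (D ◁ lui X)).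
    + pointwise. rewrite2 (lu_nat (swap D K X)).
      rewrite2_rev (lu_nat (D ◁ lui X)). rewrite2_rev (swap_nat D K (lui X)).
      rewrite (tail2 (whisker2 D (eq_sym (lui_nat (lui X))))). now flat.
    + rewrite <- swap_hexr.
      assert (E : lu (D ⊗ X) ∘ lu (K ⊗ D ⊗ X) ∘ asc K K (D ⊗ X)
        = lu (D ⊗ X) ∘ (lu K ▷ (D ⊗ X))) by coh.
      pointwise. now rewrite3 E.
  - pointwise. rewrite2 (eq_sym (swap_nat2 D X (lu K))).
    assert (E : (D ◁ (lu K ▷ X)) ∘ (D ◁ asci K K X) ∘ (D ◁ lui (K ⊗ X))
      = idm (D ⊗ K ⊗ X)) by coh.
    rewrite3 E. now rewrite comp_idl. }
assert (kid : k = idm _).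
{ destruct (swap_iso D K X) as [g [g1 g2]].
  set (k' := (D ◁ lu X) ∘ g ∘ lui (D ⊗ X)).
  assert (k'k : k' ∘ k = idm _).
  { unfold k, k'. pointwise. rewrite (tail2 (lui_lu (D ⊗ X))), comp_idl.
    rewrite (tail2 g1), comp_idl.
    rewrite (tail2 (whisker2 D (lu_lui X))), tensm_id. now rewrite comp_idl. }
  rewrite <- (comp_idl k), <- k'k, <- comp_assoc, kk. exact eq_refl. }
rewrite <- (comp_idl (D ◁ lu X)), <- kid. unfold k. pointwise.
now rewrite (tail2 (whisker2 D (lui_lu X))), tensm_id, comp_idl.
Qed.

Lemma swap_lift10r (A B X : C) (e : Hom A K) :
  lift10 e (B ⊗ X) ∘ swap B A X = B ◁ lift10 e X.
Proof.
unfold lift10. pointwise. rewrite2_rev (swap_nat2 B X e). now rewrite2 (swap_unitr B X).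
Qed.

Lemma swap_lift01 (A B X : C) (u : Hom K A) :
  swap A B X ∘ lift01 u (B ⊗ X) = B ◁ lift01 u X.
Proof.
unfold lift01. pointwise. rewrite2 (swap_nat1 B X u).
transitivity ((B ◁ (u ▷ X)) ∘ ((B ◁ lui X) ∘ ((B ◁ lu X) ∘ swap K B X)
  ∘ (lui (B ⊗ X) ∘ z))).
- flat. rewrite (tail2 (whisker2 B (lui_lu X))), tensm_id. now rewrite comp_idl.
- rewrite swap_unitl. flat. now rewrite (tail2 (lu_lui (B ⊗ X))), comp_idl.
Qed.

Lemma swap_tail (A B Y X : C) :
  swap A B Y ▷ X
  = asci B (A ⊗ Y) X ∘ (B ◁ asci A Y X) ∘ swap A B (Y ⊗ X)
    ∘ (A ◁ asc B Y X) ∘ asc A (B ⊗ Y) X.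
Proof.
transitivity (lift12 (braid A B) Y ▷ X ∘ (asci A B Y ▷ X)).
{ unfold swap, lift12. now rewrite !comp_whisker. }
rewrite lift12_tail. unfold lift12, swap. rassoc. do 4 f_equal. coh.
Qed.

(** All compatibility axioms have the left side as their last part.  After the
    crossing of the second output of [d] with [D], the maps [g] and [f] act one
    after the other. *)
Lemma mid_lift12 (A A1 A2 D E P Y : C) (d : Hom A (A1 ⊗ A2))
    (f : Hom (A1 ⊗ D) P) (g : Hom (A2 ⊗ E) Y) :
  (f ⊠ g) ∘ mid A1 A2 D E ∘ (d ▷ (D ⊗ E))
  = lift21 f Y ∘ (A1 ◁ D ◁ g) ∘ (A1 ◁ swap A2 D E) ∘ lift12 d (D ⊗ E).
Proof.
rewrite <- tensm_lift21. unfold mid, swap, lift12. now pointwise.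
Qed.

(** In Sweedler notation, [δ(ab) = a1 b1 ⊗ a2 b2], with a single crossing, of [a2]
    past [b1]. *)
Lemma bialgebra_lift (A X : C) (mu : Hom (A ⊗ A) A) (delta : Hom A (A ⊗ A)) :
  delta ∘ mu = tens_mu mu mu ∘ (delta ⊠ delta) ->
  lift12 delta X ∘ lift21 mu X
  = lift21 mu (A ⊗ X) ∘ (A ◁ A ◁ lift21 mu X) ∘ (A ◁ swap A A (A ⊗ X))
    ∘ lift12 delta (A ⊗ A ⊗ X) ∘ (A ◁ lift12 delta X).
Proof.
unfold tens_mu. rewrite (tensm_split delta), comp_assoc, mid_lift12. intros e.
transitivity (asc A A X ∘ ((delta ∘ mu) ▷ X) ∘ asci A A X).
{ unfold lift12, lift21. rewrite comp_whisker. now pointwise. }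
rewrite e, !comp_whisker, lift21_tail, !whisker_tail, swap_tail.
rewrite lift12_tail, lift21_asc, lift12_asci.
pointwise.
repeat (first [ rewrite (tail2 (asci_asc _ _ _))
  | rewrite (tail2 (asc_asci _ _ _))
  | rewrite (tail2 (whisker2 _ (asci_asc _ _ _)))
  | rewrite (tail2 (whisker2 _ (asc_asci _ _ _)))
  | rewrite (tail2 (whisker2 _ (whisker2 _ (asci_asc _ _ _))))
  | rewrite (tail2 (whisker2 _ (whisker2 _ (asc_asci _ _ _)))) ];
  rewrite ?tensm_id, ?comp_idl).
rewrite2_rev (lift12_nat delta (asc A A X)).
now rewrite (tail2 (whisker2 _ (asc_asci _ _ _))), tensm_id, comp_idl.
Qed.

End Braid.

(** * Hopf braces and their modules *)

Section BraceModules.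
Variables (C : StrictBraidedCategory) (HB : HopfBrace C).

Notation δ := (lift12 (hb_delta HB)).
Notation ε := (lift10 (hb_eps HB)).
Notation μ1 := (lift21 (hb_mu1 HB)).
Notation μ2 := (lift21 (hb_mu2 HB)).
Notation η1 := (lift01 (hb_eta1 HB)).
Notation η2 := (lift01 (hb_eta2 HB)).
Notation σ := (swap (hb_ob HB) (hb_ob HB)).
Notation lam X := (hb_lam1 HB ▷ X).
Notation H := (hb_ob HB).

(** The coproduct of the coalgebra [H ⊗ H]; its coassociativity is where the
    hexagons enter. *)
Definition comulHH (X : C) : Hom (H ⊗ H ⊗ X) (H ⊗ H ⊗ H ⊗ H ⊗ X) :=
  (H ◁ σ (H ⊗ X)) ∘ δ (H ⊗ H ⊗ X) ∘ (H ◁ δ X).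

Lemma coassoc_H (X : C) : δ (H ⊗ X) ∘ δ X = (H ◁ δ X) ∘ δ X.
Proof. apply lift12_coassoc, (hopf_coalgebra (hb_hopf1 HB)). Qed.

Lemma counitl_H (X : C) : ε (H ⊗ X) ∘ δ X = idm (H ⊗ X).
Proof. apply lift10_lift12, (hopf_coalgebra (hb_hopf1 HB)). Qed.

Lemma comul_mul2 (X : C) : μ2 (H ⊗ X) ∘ (H ◁ H ◁ μ2 X) ∘ comulHH X = δ X ∘ μ2 X.
Proof.
unfold comulHH. rewrite (bialgebra_lift X (algm_mul (hopf_delta (hb_hopf2 HB)))).
now pointwise.
Qed.

Lemma counit_mul2 (X : C) : ε X ∘ μ2 X = ε X ∘ ε (H ⊗ X).
Proof. apply lift10_lift21, (hopf_eps (hb_hopf2 HB)). Qed.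

Lemma antipode1_l (X : C) : μ1 X ∘ lam (H ⊗ X) ∘ δ X = η1 X ∘ ε X.
Proof. apply antipodel_lift, (hopf_antipodel (hb_hopf1 HB)). Qed.

Lemma antipode1_r (X : C) : μ1 X ∘ (H ◁ lam X) ∘ δ X = η1 X ∘ ε X.
Proof. apply antipoder_lift, (hopf_antipoder (hb_hopf1 HB)). Qed.

Lemma comulHH_nat (X Y : C) (f : Hom X Y) :
  comulHH Y ∘ (H ◁ H ◁ f) = (H ◁ H ◁ H ◁ H ◁ f) ∘ comulHH X.
Proof.
unfold comulHH. pointwise.
rewrite2 (whisker2 H (lift12_nat (hb_delta HB) f)).
rewrite2 (lift12_nat (hb_delta HB) (H ◁ H ◁ f)).
rewrite (tail2 (whisker2 H (swap_nat H H (H ◁ f)))). now flat.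
Qed.

Lemma comulHH_counit (X : C) :
  ε (H ⊗ H ⊗ X) ∘ ε (H ⊗ H ⊗ H ⊗ X) ∘ comulHH X
  = idm (H ⊗ H ⊗ X).
Proof.
unfold comulHH. pointwise.
rewrite2 (lift10_nat (hb_eps HB) (σ (H ⊗ X))).
rewrite (tail2 (counitl_H (H ⊗ H ⊗ X))), comp_idl.
rewrite2 (swap_lift10r H (H ⊗ X) (hb_eps HB)).
rewrite (tail2 (whisker2 H (counitl_H X))). now rewrite tensm_id.
Qed.

Lemma comulHH_coassoc (X : C) :
  comulHH (H ⊗ H ⊗ X) ∘ comulHH X = (H ◁ H ◁ comulHH X) ∘ comulHH X.
Proof.
unfold comulHH. pointwise.
rewrite2 (whisker2 H (lift12_swap H (H ⊗ X) (hb_delta HB))).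
rewrite2 (lift12_nat (hb_delta HB) (H ◁ σ (H ⊗ X))).
rewrite2 (lift12_nat (hb_delta HB) (σ (H ⊗ H ⊗ X))).
rewrite2 (lift12_nat (hb_delta HB) (H ◁ δ (H ⊗ X))).
rewrite2 (coassoc_H (H ⊗ H ⊗ X)).
rewrite (tail2 (whisker2 H (eq_sym (lift12_nat (hb_delta HB) (δ (H ⊗ X)))))). flat.
rewrite2_rev (lift12_nat (hb_delta HB) (δ (H ⊗ X))).
rewrite2 (whisker2 H (coassoc_H X)).
rewrite (tail2 (whisker2 H (swap_nat H H (σ (H ⊗ X))))). flat.
rewrite (tail2 (whisker2 H (eq_sym (swap_nat H H (δ X))))). flat.
rewrite2 (whisker2 H (swap_lift12 H (H ⊗ H ⊗ X) (hb_delta HB))).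
rewrite2_rev (lift12_nat (hb_delta HB) (H ◁ δ X)).
reflexivity.
Qed.

Notation μ1b := (hb_mu1 HB).
Notation μ2b := (hb_mu2 HB).

Section Module.
Variables (M : C) (psi1 psi2 : Hom (H ⊗ M) M).
Hypothesis HM : IsBraceModule psi1 psi2.
Notation Γ := (Gamma_mod psi1 psi2).

Lemma Gamma_lifts : Γ = psi1 ∘ lam M ∘ (H ◁ psi2) ∘ δ M.
Proof.
unfold Gamma_mod, Gamma. rewrite (tensm_split _ psi2). unfold lift12. now pointwise.
Qed.

Lemma act1_assoc : psi1 ∘ (H ◁ psi1) = psi1 ∘ μ1 M.
Proof. apply lift21_assoc, (mod_assoc (bmod_module1 HM)). Qed.
Lemma act2_assoc : psi2 ∘ (H ◁ psi2) = psi2 ∘ μ2 M.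
Proof. apply lift21_assoc, (mod_assoc (bmod_module2 HM)). Qed.
Lemma act1_unit : psi1 ∘ η1 M = idm M.
Proof. apply lift01_act, (mod_unit (bmod_module1 HM)). Qed.
Lemma act2_unit : psi2 ∘ η2 M = idm M.
Proof. apply lift01_act, (mod_unit (bmod_module2 HM)). Qed.

Lemma act_compat :
  psi2 ∘ (H ◁ psi1) = psi1 ∘ μ2 M ∘ (H ◁ H ◁ Γ) ∘ (H ◁ σ M) ∘ δ (H ⊗ M).
Proof.
rewrite (bmod_compat HM).
transitivity (psi1 ∘ ((hb_mu2 HB ⊠ Γ) ∘ mid H H H M ∘ (hb_delta HB ▷ (H ⊗ M)))).
{ now rassoc. } rewrite mid_lift12. now pointwise.
Qed.

(** [h1.Γ(h2, m) = h1.S(h2).(h3*m) = h*m]. *)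
Lemma act2_eq_act1_Gamma : psi1 ∘ (H ◁ Γ) ∘ δ M = psi2.
Proof.
rewrite Gamma_lifts. pointwise.
rewrite2_rev (coassoc_H M). rewrite2_rev (lift12_nat (hb_delta HB) psi2).
rewrite2 act1_assoc. rewrite3 (antipode1_r M). rewrite (tail2 act1_unit), comp_idl.
rewrite2 (lift10_nat (hb_eps HB) psi2). now rewrite (tail2 (counitl_H M)), comp_idl.
Qed.

(** The convolution [(h1*g1).t(h2, g2, m)] of the product of [H_2] with [t], over the
    coalgebra [H ⊗ H]. *)
Definition mul2_act (t : Hom (H ⊗ H ⊗ M) M) : Hom (H ⊗ H ⊗ M) M :=
  psi1 ∘ μ2 M ∘ (H ◁ H ◁ t) ∘ comulHH M.

(** The product of [H_2] is a morphism of coalgebras, so composing it with the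
    antipode of [H_1] gives its convolution inverse:
    [S(h1*g1).(h2*g2).t(h3, g3, m) = t(h, g, m)]. *)
Lemma mul2_act_inverse (t : Hom (H ⊗ H ⊗ M) M) :
  psi1 ∘ lam M ∘ μ2 M ∘ (H ◁ H ◁ mul2_act t) ∘ comulHH M = t.
Proof.
unfold mul2_act. pointwise.
rewrite2_rev (comulHH_coassoc M).
rewrite2_rev (comulHH_nat t).
rewrite2 (lift21_nat (hb_mu2 HB) psi1).
rewrite3 (comul_mul2 M).
rewrite2 (interchange (hb_lam1 HB) psi1). rewrite2 act1_assoc.
rewrite3 (antipode1_l M). rewrite (tail2 act1_unit), comp_idl.
rewrite2 (counit_mul2 M).
rewrite2 (lift10_nat (hb_eps HB) (H ◁ t)). rewrite2 (lift10_nat (hb_eps HB) t).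
now rewrite (tail3 (comulHH_counit M)), comp_idl.
Qed.

Lemma mul2_act_injective (t t' : Hom (H ⊗ H ⊗ M) M) : mul2_act t = mul2_act t' -> t = t'.
Proof. intros e. now rewrite <- (mul2_act_inverse t), e, mul2_act_inverse. Qed.

(** Convolving either side with the product gives [h*(g*m)]: for [Γ(h*g, m)] this is
    [act2_eq_act1_Gamma] at [h*g], and for [Γ(h, Γ(g, m))] it is the compatibility
    axiom applied to [h*(g1.Γ(g2, m))]. *)
Lemma Gamma_assoc : Γ ∘ (H ◁ Γ) = Γ ∘ μ2 M.
Proof.
apply mul2_act_injective. transitivity (psi2 ∘ μ2 M).
- rewrite <- act2_assoc. transitivity (psi2 ∘ (H ◁ (psi1 ∘ (H ◁ Γ) ∘ δ M))).
  2: now rewrite act2_eq_act1_Gamma.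
  unfold mul2_act, comulHH. pointwise. rewrite2 act_compat.
  rewrite2 (lift12_nat (hb_delta HB) (H ◁ Γ)).
  now rewrite (tail2 (whisker2 H (swap_nat H H Γ))); flat.
- unfold mul2_act. pointwise. rewrite2 (lift21_nat (hb_mu2 HB) Γ). rewrite3 (comul_mul2 M).
  now rewrite3 act2_eq_act1_Gamma.
Qed.

(** The compatibility axiom, applied to [h2*(g.m)] inside [S(h1).(h2*(g.m))],
    together with coassociativity. *)
Lemma Gamma_act1_lifted :
  Γ ∘ (H ◁ psi1)
  = psi1 ∘ lift21 (Gamma_brace HB) M ∘ (H ◁ H ◁ Γ) ∘ (H ◁ σ M) ∘ δ (H ⊗ M).
Proof.
unfold Gamma_brace, Gamma. rewrite lift21_Gamma.
transitivity (psi1 ∘ lam M ∘ (H ◁ psi2) ∘ δ M ∘ (H ◁ psi1)).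
{ now rewrite Gamma_lifts. }
pointwise. rewrite2 (lift12_nat (hb_delta HB) psi1).
rewrite2 (whisker2 H act_compat).
rewrite2 (interchange (hb_lam1 HB) psi1). rewrite2 act1_assoc.
rewrite2 (lift12_nat (hb_delta HB) (H ◁ Γ)). rewrite2 (lift12_nat (hb_delta HB) (σ M)).
now rewrite2 (coassoc_H (H ⊗ M)).
Qed.
End Module.

(** The defining axiom of a Hopf brace is the compatibility of [H] as a module
    over the brace. *)
Lemma regular_module : IsBraceModule μ1b μ2b.
Proof.
split.
- split; apply (hopf_algebra (hb_hopf1 HB)).
- split; apply (hopf_algebra (hb_hopf2 HB)).
- apply hb_compat.
Qed.

Lemma comul_unit2 (X : C) : δ X ∘ η2 X = η2 (H ⊗ X) ∘ η2 X.
Proof. apply lift12_lift01, (algm_unit (hopf_delta (hb_hopf2 HB))). Qed.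

(** Let [u] be the unit of [H_2]; it is grouplike.  The compatibility axiom at [h = u]
    reads [a.b = a.S(u).b], so [S(u)] is neutral for the first product. *)
Lemma antipode1_unit2 : hb_lam1 HB ∘ hb_eta2 HB = hb_eta1 HB.
Proof.
(* Γ(u, b) = S(u).b, since u acts trivially by the second action. *)
assert (E1 : Gamma_mod μ1b μ2b ∘ η2 H = μ1b ∘ lam H ∘ η2 H).
{ rewrite Gamma_lifts. pointwise. rewrite2 (comul_unit2 H).
  rewrite2_rev (lift01_nat (hb_eta2 HB) μ2b).
  now rewrite (tail2 (act2_unit regular_module)), comp_idl. }
(* a.(S(u).b) = u*(a.b) = a.b *)
assert (E2 : μ1b ∘ (H ◁ (μ1b ∘ lam H ∘ η2 H)) = μ1b).
{ rewrite <- E1.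
  transitivity (μ2b ∘ (H ◁ μ1b) ∘ η2 (H ⊗ H)).
  - rewrite (act_compat regular_module). pointwise. rewrite2 (comul_unit2 (H ⊗ H)).
    rewrite2_rev (lift01_nat (hb_eta2 HB) (σ H)). rewrite2 (swap_lift01 H H (hb_eta2 HB)).
    rewrite2_rev (lift01_nat (hb_eta2 HB) (H ◁ Gamma_mod μ1b μ2b)).
    rewrite (tail2 (lift21_lift01 H (alg_unitl (hopf_algebra (hb_hopf2 HB))))).
    now rewrite comp_idl.
  - pointwise. rewrite2_rev (lift01_nat (hb_eta2 HB) μ1b).
    now rewrite (tail2 (act2_unit regular_module)), comp_idl. }
(* The previous identity at a = 1. *)
assert (E3 : μ1b ∘ lam H ∘ η2 H = idm H).
{ transitivity (μ1b ∘ (H ◁ (μ1b ∘ lam H ∘ η2 H)) ∘ η1 H).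
  - rewrite <- (comp_assoc μ1b (H ◁ _)), <- (lift01_nat (hb_eta1 HB)).
    rewrite (comp_assoc μ1b (η1 H)).
    now rewrite (act1_unit regular_module), comp_idl.
  - rewrite E2. apply (act1_unit regular_module). }
rewrite <- (comp_idl (hb_eta1 HB)), <- E3.
rewrite <- (comp_assoc μ1b), lift01_comp, <- comp_assoc, lift01_nat, comp_assoc.
now rewrite (alg_unitr (hopf_algebra (hb_hopf1 HB))), ru_lift01.
Qed.

(** For the grouplike unit [u] of [H_2], [1 = u.S(u) = u.1] in [H_1]. *)
Lemma unit2_eq_unit1 : hb_eta2 HB = hb_eta1 HB.
Proof.
transitivity (μ1b ∘ (idm H ⊠ hb_lam1 HB) ∘ hb_delta HB ∘ hb_eta2 HB).
- rewrite <- (comp_assoc (μ1b ∘ _)), (algm_unit (hopf_delta (hb_hopf2 HB))).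
  unfold tens_eta. rewrite comp_assoc, <- (comp_assoc μ1b), <- tensm_comp.
  rewrite antipode1_unit2, comp_idl.
  rewrite (tensm_split (hb_eta2 HB)), interchange, comp_assoc.
  rewrite (alg_unitr (hopf_algebra (hb_hopf1 HB))), ru_nat, <- comp_assoc.
  assert (E : ru K ∘ lui K = idm (K : C)) by coh.
  now rewrite E, comp_idr.
- pose proof (hopf_antipoder (hb_hopf1 HB)) as E. unfold convolution in E.
  rewrite E, <- comp_assoc, (algm_unit (hopf_eps (hb_hopf2 HB))). apply comp_idr.
Qed.

Lemma Gamma_unit (M : C) (psi1 psi2 : Hom (H ⊗ M) M)
    (HM : IsBraceModule psi1 psi2) :
  Gamma_mod psi1 psi2 ∘ η2 M = idm M.
Proof.
rewrite Gamma_lifts. pointwise. rewrite2 (comul_unit2 M).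
rewrite2_rev (lift01_nat (hb_eta2 HB) psi2).
rewrite (tail2 (act2_unit HM)), comp_idl.
rewrite (tail2 (lift01_comp M (hb_lam1 HB) (hb_eta2 HB))), antipode1_unit2.
now rewrite (tail2 (act1_unit HM)), comp_idl.
Qed.

Lemma Gamma_module (M : C) (psi1 psi2 : Hom (H ⊗ M) M)
    (HM : IsBraceModule psi1 psi2) :
  IsModule (A := hb_H2 HB) (Gamma_mod psi1 psi2).
Proof.
split; simpl.
- now rewrite <- lift01_lu, comp_assoc, (Gamma_unit HM), comp_idl.
- now rewrite (Gamma_assoc HM), (lift21_asc (hb_mu2 HB)), comp_assoc.
Qed.

Lemma Gamma_act1 (M : C) (psi1 psi2 : Hom (H ⊗ M) M)
    (HM : IsBraceModule psi1 psi2) :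
  Gamma_mod psi1 psi2 ∘ (H ◁ psi1)
  = psi1 ∘ (Gamma_brace HB ⊠ Gamma_mod psi1 psi2) ∘ mid H H H M
    ∘ (hb_delta HB ▷ (H ⊗ M)).
Proof.
rewrite (Gamma_act1_lifted HM).
transitivity (psi1 ∘ ((Gamma_brace HB ⊠ Gamma_mod psi1 psi2) ∘ mid H H H M
    ∘ (hb_delta HB ▷ (H ⊗ M)))); [|now rassoc].
rewrite mid_lift12. now rassoc.
Qed.

Lemma Gamma_cocycle (M : C) (psi1 psi2 : Hom (H ⊗ M) M)
    (HM : IsBraceModule psi1 psi2) :
  psi2 = psi1 ∘ (H ◁ Gamma_mod psi1 psi2) ∘ asc H H M ∘ (hb_delta HB ▷ M).
Proof.
transitivity (psi1 ∘ (H ◁ Gamma_mod psi1 psi2) ∘ δ M).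
- symmetry. apply (act2_eq_act1_Gamma HM).
- unfold lift12. now rassoc.
Qed.

(** With a common unit [1], [S(h1).(h2*1) = S(h1).h2 = ε(h)1]. *)
Lemma Gamma_brace_unit :
  Gamma_brace HB ∘ (H ◁ hb_eta1 HB) = lu H ∘ (hb_eps HB ⊠ hb_eta1 HB).
Proof.
rewrite lu_tensm_unit.
transitivity (Gamma_mod μ1b μ2b ∘ (H ◁ hb_eta2 HB)); [now rewrite unit2_eq_unit1|].
rewrite Gamma_lifts. pointwise. rewrite2 (lift12_nat (hb_delta HB) (hb_eta2 HB)).
rewrite (tail2 (whisker2 H (alg_unitr (hopf_algebra (hb_hopf2 HB))))).
rewrite2 (lift12_ru (hb_delta HB)).
pose proof (hopf_antipodel (hb_hopf1 HB)) as E. unfold convolution in E.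
now rewrite3 E.
Qed.

Lemma idm_iso (X : C) : is_iso (idm X).
Proof. exists (idm X); split; apply comp_idl. Qed.

Lemma id_cocycle : IsInvertibleCocycle (A := hb_H2 HB) (H := hb_H1 HB)
                 (Gamma_brace HB) (idm (hb_ob HB)).
Proof.
split.
- split.
  + apply (hopf_algebra (hb_hopf1 HB)).
  + apply (Gamma_module regular_module).
  + apply Gamma_brace_unit.
  + apply (Gamma_act1 regular_module).
- split; simpl.
  + apply comp_idr.
  + now rewrite tensm_id, comp_idl, comp_idr.
- apply idm_iso.
- simpl. rewrite comp_idl. apply (Gamma_cocycle regular_module).
Qed.

Lemma Gamma_morphism (M N : BraceModule HB) (f : BraceModuleHom M N) :
  bmh f ∘ Gamma_mod (bm_psi1 M) (bm_psi2 M)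
  = Gamma_mod (bm_psi1 N) (bm_psi2 N) ∘ (H ◁ bmh f).
Proof.
assert (f1 : bm_psi1 N ∘ (H ◁ bmh f) = bmh f ∘ bm_psi1 M)
  by (symmetry; apply (bmh_mod1 f)).
assert (f2 : bm_psi2 N ∘ (H ◁ bmh f) = bmh f ∘ bm_psi2 M)
  by (symmetry; apply (bmh_mod2 f)).
rewrite !Gamma_lifts. pointwise.
rewrite2 (lift12_nat (hb_delta HB) (bmh f)). rewrite2 (whisker2 H f2).
rewrite2 (interchange (hb_lam1 HB) (bmh f)). now rewrite2 f1.
Qed.
End BraceModules.

(** * The functor *)

Theorem theorem2p25 (C : StrictBraidedCategory) (HB : HopfBrace C) :
  exists hid : IsInvertibleCocycle (A := hb_H2 HB) (H := hb_H1 HB)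
                 (Gamma_brace HB) (idm (hb_ob HB)),
  let p : InvertibleCocycle C :=
    @Build_InvertibleCocycle C (hb_H2 HB) (hb_H1 HB)
      (Gamma_brace HB) (idm (hb_ob HB)) hid in
  exists (hobj : forall M : BraceModule HB,
            @IsCocycleModule C p (bm_ob M) (bm_ob M)
              (Gamma_mod (bm_psi1 M) (bm_psi2 M)) (bm_psi1 M) (bm_psi2 M)
              (idm (bm_ob M))),
  let G0 (M : BraceModule HB) : CocycleModule p :=
    @Build_CocycleModule C p (bm_ob M) (bm_ob M)
      (Gamma_mod (bm_psi1 M) (bm_psi2 M)) (bm_psi1 M) (bm_psi2 M)
      (idm (bm_ob M)) (hobj M) in
  exists (hmor : forall (M N : BraceModule HB) (f : BraceModuleHom M N),
            @IsCocycleModuleHom C p (G0 M) (G0 N) (bmh f) (bmh f)),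
  let G1 (M N : BraceModule HB) (f : BraceModuleHom M N)
      : CocycleModuleHom (G0 M) (G0 N) :=
    @Build_CocycleModuleHom C p (G0 M) (G0 N) (bmh f) (bmh f) (hmor M N f) in
  @IsFunctor (BraceMod HB) (CocycleMod p) G0 G1.
Proof.
exists (id_cocycle HB).
intros p.
assert (hobj : forall M : BraceModule HB,
            @IsCocycleModule C p (bm_ob M) (bm_ob M)
              (Gamma_mod (bm_psi1 M) (bm_psi2 M)) (bm_psi1 M) (bm_psi2 M)
              (idm (bm_ob M))).
{ intros M. pose proof (bm_ax M) as HM. split.
  - apply (Gamma_module HM).
  - apply (bmod_module1 HM).
  - apply (Gamma_act1 HM).
  - apply (bmod_module2 HM).
  - apply idm_iso.
  - rewrite comp_idl. apply (Gamma_cocycle HM). }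
exists hobj. intros G0.
assert (hmor : forall (M N : BraceModule HB) (f : BraceModuleHom M N),
            @IsCocycleModuleHom C p (G0 M) (G0 N) (bmh f) (bmh f)).
{ intros M N f. split.
  - apply Gamma_morphism.
  - apply (bmh_mod1 f).
  - apply (bmh_mod2 f).
  - simpl. now rewrite comp_idl, comp_idr. }
exists hmor. intros G1.
split; intros; now apply CocycleModuleHom_eq.
Qed.
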